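(* Let $\beta>1$, $0<\alpha<1$ and $0<\phi<1$. If $\gamma$ is sufficiently large (i.e. there is $\gamma_*\ge 0$ depending on $\alpha,\beta,\phi$ such that the following holds for all $\gamma>\gamma_*$), then the right-pushed beta density $x\mapsto\text{RPushBeta}(x|\alpha,\beta,\gamma,\phi)$ is neither quasi-concave nor quasi-convex. In this case, as $x$ increases over $(0,1)$, the slope of the density starts negative, turns positive, then turns negative again.
   Context: For $\alpha>0$, $\beta>0$, $\gamma\ge 0$, $0\le\phi\le 1$, the right-pushed beta density is $$\text{RPushBeta}(x|\alpha,\beta,\gamma,\phi)=\frac{x^{\alpha-1}(1-x)^{\beta-1}(1-\phi+x\phi)^{\gamma}}{\int_0^1 t^{\alpha-1}(1-t)^{\beta-1}(1-\phi+t\phi)^{\gamma}\,dt},\qquad 0\le x\le 1.$$ A function $f$ is quasi-concave if $f(\lambda x+(1-\lambda)y)\ge\min(f(x),f(y))$, and quasi-convex if $f(\lambda x+(1-\lambda)y)\le\max(f(x),f(y))$, for all $x,y$ and $0\le\lambda\le1$. *)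

(* Defs.v *)
From HB Require Import structures.
From mathcomp Require Import all_boot all_order all_algebra.
From mathcomp Require Import all_classical all_reals all_analysis.

Set Implicit Arguments.
Unset Strict Implicit.
Unset Printing Implicit Defensive.

Import Order.TTheory GRing.Theory Num.Theory.
Import numFieldNormedType.Exports.

Local Open Scope classical_set_scope.
Local Open Scope ring_scope.

(* x ^ p for x >= 0, with 0 ^ p = +oo when p < 0; [powR] alone would give 0,
   and the density would then wrongly vanish at 0 for alpha < 1. *)
Definition epowR (R : realType) (x p : R) : \bar R :=
  if (x == 0) && (p < 0) then +oo%E else (x `^ p)%:E.

(* Meaningful for 0 <= x <= 1. *)
Definition RPushBeta_kernel (R : realType) (alpha beta gamma phi x : R) :
    \bar R :=
  (epowR x (alpha - 1) * epowR (1 - x) (beta - 1)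
    * epowR (1 - phi + x * phi) gamma)%E.

(* The density on [0, 1]; it takes the value +oo at x = 0 when alpha < 1 and
   phi < 1, and is finite on the open interval ]0, 1[. *)
Definition RPushBeta (R : realType) (alpha beta gamma phi x : R) : \bar R :=
  (RPushBeta_kernel alpha beta gamma phi x
    / \int[lebesgue_measure]_(t in `[0%R, 1%R])
        RPushBeta_kernel alpha beta gamma phi t)%E.

Definition quasi_concave (R : realType) (A : set R) (f : R -> \bar R) : Prop :=
  forall x y l : R, A x -> A y -> 0 <= l <= 1 ->
    (Order.min (f x) (f y) <= f (l * x + (1 - l) * y)%R)%E.

Definition quasi_convex (R : realType) (A : set R) (f : R -> \bar R) : Prop :=
  forall x y l : R, A x -> A y -> 0 <= l <= 1 ->
    (f (l * x + (1 - l) * y)%R <= Order.max (f x) (f y))%E.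

Definition slope_neg_pos_neg (R : realType) (f : R -> R) : Prop :=
  (forall x : R, 0 < x < 1 -> derivable f x 1) /\
  exists a b : R, 0 < a /\ a < b /\ b < 1 /\
    (forall x : R, 0 < x < a -> derive1 f x < 0) /\
    (forall x : R, a < x < b -> 0 < derive1 f x) /\
    (forall x : R, b < x < 1 -> derive1 f x < 0).

(* Main.v *)
(** On ]0, 1[ the derivative of the density is the density times
    [(alpha - 1) / x - (beta - 1) / (1 - x) + gamma phi / (1 - phi + x phi)],
    whose sign is that of a quadratic [q] with [q 0 < 0] and [q 1 < 0]. For
    large [gamma] the leading coefficient of [q] is negative and [q (1/2) > 0],
    so [q] has exactly two roots [0 < a < b < 1] and is negative, positive,
    negative. As the density is [+oo] at 0 and vanishes at 1, the valley [a]
    between 0 and [b] refutes quasi-concavity and the peak [b] between [a] and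
    1 refutes quasi-convexity. The normalizing integral is finite because
    [x `^ (alpha - 1)] dominates the kernel. *)
Require Import Defs.
From mathcomp Require Import all_boot all_order all_algebra.
From mathcomp Require Import all_classical all_reals all_analysis.
From mathcomp Require Import measurable_realfun ring lra.
Import Order.TTheory GRing.Theory Num.Theory.
Import numFieldNormedType.Exports.
Local Open Scope classical_set_scope.
Local Open Scope ring_scope.

(** * Integrability of the singular power near 0 *)

(** With the antiderivative t^p / p the integral is (1 - a^p) / p. Taking a > 0 keeps away from the
    singularity at 0 that occurs for p < 1. *)
Lemma integral_powRB1_segment_le (R : realType) (p a : R) : 0 < p -> 0 < a <= 1 ->
  (\int[lebesgue_measure]_(t in `[a, 1%R]) (t `^ (p - 1))%:E <= (p^-1)%:E)%E.
Proof.
move=> p0 /andP[a0]; rewrite le_eqVlt => /predU1P[->|a1].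
  by rewrite set_itv1 integral_set1 lee_fin invr_ge0 ltW.
have dF (x : R) : 0 < x -> is_derive x 1 (fun t => p^-1 * t `^ p) (x `^ (p - 1)).
  move=> x0; have dp := is_derive1_powR p x0.
  have := is_deriveZ p^-1 dp.
  by rewrite /GRing.scale/= mulrA mulVf ?gt_eqF// mul1r.
have cF (x : R) : 0 < x -> {for x, continuous (fun t => p^-1 * t `^ p)}.
  move=> x0; apply/differentiable_continuous/derivable1_diffP.
  by have [] := dF _ x0.
rewrite (@continuous_FTC2 _ _ (fun t => p^-1 * t `^ p))//.
- rewrite powR1 -EFinB lee_fin mulr1 gerBl mulr_ge0 ?invr_ge0 ?powR_ge0//.
  exact: ltW.
- apply: derivable_within_continuous => x; rewrite in_itv/= => /andP[ax _].
  by have [] := is_derive1_powR (p - 1) (lt_le_trans a0 ax).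
- split.
  + move=> x; rewrite in_itv/= => /andP[ax _].
    by have [] := dF _ (lt_trans a0 ax).
  + exact/cvg_at_right_filter/cF.
  + exact/cvg_at_left_filter/cF.
- move=> x; rewrite in_itv/= => /andP[ax _].
  by rewrite derive1E; have [_ ->] := dF _ (lt_trans a0 ax).
Qed.

Lemma measurable_powR_EFin (R : realType) (D : set R) (p : R) :
  measurable_fun D (EFin \o (fun t : R => t `^ p)).
Proof.
by apply/measurable_EFinP; apply: (@measurable_funTS _ _ _ _ D (@powR R ^~ p)).
Qed.

(** Monotone convergence along the segments [1/(n+1), 1], which exhaust ]0, 1]. *)
Lemma integral_powRB1_le (R : realType) (p : R) : 0 < p ->
  (\int[lebesgue_measure]_(t in `]0%R, 1%R]) (t `^ (p - 1))%:E <= (p^-1)%:E)%E.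
Proof.
move=> p0; rewrite itv_open_bnd_bigcup.
set F := fun n : nat => [set` Interval (BLeft (0 + n.+1%:R^-1 : R)) (BSide false 1)].
have cvgF : (\int[lebesgue_measure]_(t in F n) (t `^ (p - 1))%:E)%E @[n --> \oo]
    --> (\int[lebesgue_measure]_(t in \bigcup_n F n) (t `^ (p - 1))%:E)%E.
  apply: ge0_nondecreasing_set_cvg_integral => //.
  - move=> m n mn; rewrite subsetEset /F; apply: subset_itvr.
    by rewrite bnd_simp lerD2l lef_pV2 ?posrE// ler_nat.
  - by move=> i; exact: measurable_itv.
  - by move=> i; exact: measurable_powR_EFin.
  - by move=> i x _; rewrite lee_fin powR_ge0.
rewrite -(cvg_lim _ cvgF)//; apply: lime_le; first exact: cvgP cvgF.
apply: nearW => n; rewrite /F add0r; apply: integral_powRB1_segment_le => //.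
by rewrite invr_gt0 ltr0n/= invf_le1 ?ler1n.
Qed.

(** * The real-valued kernel and its finite, positive mass *)

(** Real-valued so that it can be differentiated. For alpha < 1 its value at 0 is the default 0 of
    [powR], not +oo. *)
Definition RPushBeta_kernelR (R : realType) (alpha beta gamma phi x : R) : R :=
  x `^ (alpha - 1) * (1 - x) `^ (beta - 1) * (1 - phi + x * phi) `^ gamma.

Lemma RPushBeta_kernel_EFin (R : realType) (alpha beta gamma phi x : R) :
  1 <= beta -> 0 <= gamma -> x != 0 ->
  RPushBeta_kernel alpha beta gamma phi x
    = (RPushBeta_kernelR R alpha beta gamma phi x)%:E.
Proof.
move=> b1 g0 /negbTE x0.
by rewrite /RPushBeta_kernel /epowR x0 !(ltNge _ 0) !subr_ge0 b1 g0 !andbF.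
Qed.

Lemma RPushBeta_kernelR_ge0 (R : realType) (alpha beta gamma phi x : R) :
  0 <= RPushBeta_kernelR R alpha beta gamma phi x.
Proof. by rewrite !mulr_ge0 ?powR_ge0. Qed.

Lemma pushed_base_bounds (R : realType) (phi x : R) :
  0 <= phi <= 1 -> 0 <= x <= 1 -> 1 - phi <= 1 - phi + x * phi <= 1.
Proof. by move=> /andP[? ?] /andP[? ?]; apply/andP; split; nra. Qed.

(** The other two factors have base in [0, 1] and nonnegative exponent, hence are at most 1. *)
Lemma RPushBeta_kernelR_le (R : realType) (alpha beta gamma phi x : R) :
  1 <= beta -> 0 <= gamma -> 0 <= phi <= 1 -> 0 <= x <= 1 ->
  RPushBeta_kernelR R alpha beta gamma phi x <= x `^ (alpha - 1).
Proof.
move=> b1 g0 h01 x01; have /andP[lu u1] := pushed_base_bounds _ _ _ h01 x01.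
have powR_le1 (t r : R) : 0 <= t <= 1 -> 0 <= r -> t `^ r <= 1.
  move=> /andP[t0 t1] r0; have := @ge0_ler_powR _ r r0 t 1.
  by rewrite powR1 !nnegrE; apply.
rewrite /RPushBeta_kernelR -mulrA ler_piMr ?powR_ge0// mulr_ile1 ?powR_ge0//.
  by apply: powR_le1; lra.
by apply: powR_le1 => //; rewrite u1 andbT; lra.
Qed.

Lemma measurable_RPushBeta_kernelR (R : realType) (alpha beta gamma phi : R) :
  measurable_fun setT (RPushBeta_kernelR R alpha beta gamma phi).
Proof.
apply: measurable_funM; first apply: measurable_funM => //.
- apply: (@measurableT_comp _ _ _ _ _ _ (@powR R ^~ (beta - 1))) => //.
  exact: measurable_funB.
- apply: (@measurableT_comp _ _ _ _ _ _ (@powR R ^~ gamma)) => //.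
  by apply: measurable_funD => //; exact: measurable_funM.
Qed.

(** The two kernels agree off 0, and {0} is a null set. *)
Lemma integral_RPushBeta_kernel (R : realType) (alpha beta gamma phi : R) :
  1 <= beta -> 0 <= gamma ->
  (\int[lebesgue_measure]_(t in `[0%R, 1%R])
      RPushBeta_kernel alpha beta gamma phi t
   = \int[lebesgue_measure]_(t in `]0%R, 1%R])
      (RPushBeta_kernelR R alpha beta gamma phi t)%:E)%E.
Proof.
move=> b1 g0.
have E : {in `]0%R, 1%R]%classic, (fun t => (RPushBeta_kernelR R alpha beta gamma phi t)%:E)
     =1 RPushBeta_kernel alpha beta gamma phi}.
  move=> t; rewrite inE/= in_itv/= => /andP[t0 _].
  by rewrite RPushBeta_kernel_EFin// gt_eqF.
rewrite -integral_itv_obnd_cbnd; first by apply: eq_integral => t /E.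
apply: (eq_measurable_fun _ E); apply/measurable_EFinP.
by apply: measurable_funTS; exact: measurable_RPushBeta_kernelR.
Qed.

Lemma integral_RPushBeta_kernel_fin (R : realType) (alpha beta gamma phi : R) :
  0 < alpha < 1 -> 1 <= beta -> 0 <= gamma -> 0 <= phi < 1 ->
  exists2 Z : R, 0 < Z &
    (\int[lebesgue_measure]_(t in `[0%R, 1%R])
      RPushBeta_kernel alpha beta gamma phi t)%E = Z%:E.
Proof.
move=> /andP[a0 a1] b1 g0 /andP[h0 h1].
rewrite integral_RPushBeta_kernel//; set I := (integral _ _ _).
have mf (D : set R) : measurable_fun D
    (EFin \o RPushBeta_kernelR R alpha beta gamma phi).
  apply/measurable_EFinP; apply: measurable_funTS.
  exact: measurable_RPushBeta_kernelR.
have Ile : (I <= (alpha^-1)%:E)%E.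
  apply: le_trans (integral_powRB1_le _ _ a0); apply: ge0_le_integral => //.
  - by move=> x _; rewrite lee_fin RPushBeta_kernelR_ge0.
  - exact: mf.
  - exact: measurable_powR_EFin.
  - move=> x; rewrite /= in_itv/= => /andP[x0 x1].
    by rewrite lee_fin RPushBeta_kernelR_le// ?h0 ?x1 ltW.
(* On [1/4, 1/2] one has 1 - x >= 1/2 and 1 - phi + x phi >= 1 - phi, so [c] bounds the last two
   factors from below. *)
pose c : R := (1 - 2^-1) `^ (beta - 1) * (1 - phi) `^ gamma.
have c0 : 0 < c by rewrite mulr_gt0// powR_gt0; lra.
have Igt : (0 < I)%E.
  apply: (@lt_le_trans _ _ (\int[lebesgue_measure]_(t in `[4^-1%R, 2^-1%R]) (cst (4^-1 * c)%:E) t)%E).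
    rewrite integral_cst//= lebesgue_measure_itv/= lte_fin.
    have -> : (4^-1 < 2^-1 :> R) by lra.
    by rewrite -EFinB -EFinM lte_fin; apply: mulr_gt0; [exact: mulr_gt0|lra].
  apply: (@le_trans _ _ (\int[lebesgue_measure]_(t in `[4^-1%R, 2^-1%R])
      (RPushBeta_kernelR R alpha beta gamma phi t)%:E)%E).
    apply: ge0_le_integral => //.
    - by move=> x _; rewrite lee_fin mulr_ge0// ltW.
    - exact: mf.
    - move=> x; rewrite /= in_itv/= => /andP[x4 x2].
      have x01 : 0 < x <= 1 by apply/andP; split; lra.
      rewrite lee_fin /RPushBeta_kernelR -mulrA ler_pM ?(ltW c0)//.
        (* Since 0 < x <= 1 and alpha - 1 <= 1, x^(alpha - 1) >= x >= 1/4. *)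
        by apply: le_trans x4 (ger1_powR _ _); lra.
      rewrite ler_pM ?powR_ge0// ge0_ler_powR ?nnegrE//; nra.
  apply: ge0_subset_integral => //.
  - exact: mf.
  - by move=> x _; rewrite lee_fin RPushBeta_kernelR_ge0.
  - by move=> x /=; rewrite !in_itv/= => /andP[x4 x2]; apply/andP; split; lra.
exists (fine I); first by rewrite fine_gt0// Igt (le_lt_trans Ile)// ltry.
by rewrite fineK// ge0_fin_numE ?(ltW Igt)// (le_lt_trans Ile)// ltry.
Qed.

(** * Derivative of the kernel *)

(* The numerator of the logarithmic derivative of the kernel over the common
   denominator [x (1 - x) (1 - phi + x phi)]. *)
Definition slope_quadratic (R : realType) (alpha beta gamma phi x : R) : R :=
  (alpha - 1) * (1 - x) * (1 - phi + x * phi)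
  - (beta - 1) * x * (1 - phi + x * phi) + gamma * phi * x * (1 - x).

Lemma is_derive_RPushBeta_kernelR (R : realType) (alpha beta gamma phi x : R) :
  0 <= phi < 1 -> 0 < x < 1 ->
  is_derive x 1 (RPushBeta_kernelR R alpha beta gamma phi)
    (RPushBeta_kernelR R alpha beta gamma phi x
      / (x * (1 - x) * (1 - phi + x * phi))
      * slope_quadratic R alpha beta gamma phi x).
Proof.
move=> /andP[h0 h1] /andP[x0 x1].
have y0 : 0 < 1 - x by lra.
have u0 : 0 < 1 - phi + x * phi by nra.
have dA := is_derive1_powR (alpha - 1) x0.
have dy : is_derive x 1 (fun t : R => 1 - t) (- 1).
  by apply: is_derive_eq; rewrite add0r mul1r.
have du : is_derive x 1 (fun t : R => 1 - phi + t * phi) phi.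
  by apply: is_derive_eq; rewrite /GRing.scale/=; ring.
have dB : is_derive x 1 (fun t : R => (1 - t) `^ (beta - 1)) _ :=
  @is_derive1_comp _ (fun t => t `^ (beta - 1)) (fun t => 1 - t) _ _ _
    (is_derive1_powR (beta - 1) y0) dy.
have dG : is_derive x 1 (fun t : R => (1 - phi + t * phi) `^ gamma) _ :=
  @is_derive1_comp _ (fun t => t `^ gamma) (fun t => 1 - phi + t * phi) _ _ _
    (is_derive1_powR gamma u0) du.
have dK : is_derive x 1 (RPushBeta_kernelR R alpha beta gamma phi) _ :=
  is_deriveM (is_deriveM dA dB) dG.
apply: is_derive_eq dK _.
(* Repeated use leaves only the powers with exponents alpha, beta and gamma on both sides, and the
   identity becomes one of rational functions. *)
have powRB1 (t p : R) : 0 < t -> t `^ (p - 1) = t `^ p / t.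
  by move=> t0; rewrite powRB ?powRr1 ?(ltW t0)//; rewrite (gt_eqF t0) implybT.
rewrite fctE /GRing.scale/= !(powRB1 x)// !(powRB1 (1 - x))// !(powRB1 (1 - phi + x * phi))//.
rewrite /RPushBeta_kernelR /slope_quadratic !(powRB1 x)// !(powRB1 (1 - x))//.
by field; rewrite !gt_eqF.
Qed.

(** * Roots of the slope quadratic *)

Lemma quadratic_factor (R : rcfType) (A B C : R) :
  0 < A -> 0 <= B ^+ 2 - 4 * A * C ->
  exists a b : R, a <= b /\
    forall x : R, - A * x ^+ 2 + B * x - C = A * (x - a) * (b - x).
Proof.
move=> A0 D0; pose s := Num.sqrt (B ^+ 2 - 4 * A * C).
have s0 : 0 <= s by exact: sqrtr_ge0.
have s2 : s ^+ 2 = B ^+ 2 - 4 * A * C by exact: sqr_sqrtr.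
exists ((B - s) / (2 * A)), ((B + s) / (2 * A)); split.
  by rewrite ler_pM2r ?invr_gt0 ?mulr_gt0//; lra.
move=> x.
have -> : C = (B ^+ 2 - s ^+ 2) / (4 * A) by rewrite s2; field; rewrite gt_eqF.
by field; rewrite gt_eqF.
Qed.

(** For q(x) = -A x^2 + B x - C, the last three hypotheses say q(0) < 0, q(1) < 0 and q(1/2) > 0. *)
Lemma quadratic_neg_pos_neg (R : rcfType) (A B C : R) :
  0 < A -> 0 < C -> B < A + C -> A / 4 + C < B / 2 ->
  exists a b : R, [/\ 0 < a, a < b, b < 1 &
    forall x : R, - A * x ^+ 2 + B * x - C = A * (x - a) * (b - x)].
Proof.
move=> A0 C0 B1 B2.
have [|a [b [ab f]]] := quadratic_factor R A B C A0.
  (* By the AM-GM inequality (A/4 + C)^2 >= A C, so the discriminant is nonnegative. *)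
  have BAC : (A / 4 + C) ^+ 2 <= (B / 2) ^+ 2 by rewrite ler_sqr ?nnegrE; lra.
  by have := sqr_ge0 (A / 4 - C); lra.
exists a, b.
have f0 : 0 < a * b.
  by rewrite -(pmulr_rgt0 _ A0); have := f 0; nra.
have f1 : 0 < (1 - a) * (1 - b).
  by rewrite -(pmulr_rgt0 _ A0); have := f 1; nra.
have f2 : 0 < (2^-1 - a) * (b - 2^-1).
  by rewrite -(pmulr_rgt0 _ A0); have := f 2^-1; nra.
(* The sign at 1/2 puts 1/2 strictly between the roots; the signs at 0 and 1 then give a > 0 and b <
   1. *)
have a2 : a < 2^-1 by nra.
have b2 : 2^-1 < b by nra.
by split=> //; nra.
Qed.

(** The value at 1/2 is gamma phi / 4 - (beta - alpha) (1 - phi/2) / 2, positive once gamma phi > 2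
    (beta - alpha). The summand 1 in the threshold gives gamma > 1, hence a negative leading
    coefficient. *)
Lemma slope_quadratic_factor (R : realType) (alpha beta gamma phi : R) :
  0 < alpha < 1 -> 1 < beta -> 0 < phi < 1 ->
  1 + 2 * (beta - alpha) / phi < gamma ->
  exists A a b : R, [/\ 0 < A, 0 < a, a < b, b < 1 &
    forall x : R, slope_quadratic R alpha beta gamma phi x = A * (x - a) * (b - x)].
Proof.
move=> /andP[a0 a1] b1 /andP[h0 h1] hg.
have {}hg : phi + 2 * (beta - alpha) < gamma * phi.
  by move: hg; rewrite -(ltr_pM2r h0) mulrDl mul1r divfK ?gt_eqF.
pose A := phi * (alpha + beta + gamma - 2).
pose C := (1 - alpha) * (1 - phi).
(* The middle coefficient, read off from the value -A + B - C at 1. *)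
pose B := slope_quadratic R alpha beta gamma phi 1 + A + C.
have [||||a [b [? ? ? f]]] := quadratic_neg_pos_neg R A B C.
- by rewrite /A; nra.
- by rewrite /C; nra.
- by rewrite /B /slope_quadratic; nra.
- by rewrite /B /A /C /slope_quadratic; nra.
exists A, a, b; split=> //; first by rewrite /A; nra.
by move=> x; rewrite -f /B /A /C /slope_quadratic; ring.
Qed.

(** * Shape of the density *)

Lemma RPushBetaE (R : realType) (alpha beta gamma phi : R) :
  0 < alpha < 1 -> 1 <= beta -> 0 <= gamma -> 0 <= phi < 1 ->
  exists2 Z : R, 0 < Z & forall x : R, RPushBeta alpha beta gamma phi x =
    if x == 0 then +oo%E
    else (Z^-1 * RPushBeta_kernelR R alpha beta gamma phi x)%:E.
Proof.
move=> a01 b1 g0 h01; have [/andP[_ a1] /andP[_ h1]] := (a01, h01).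
have [Z Z0 IZ] := integral_RPushBeta_kernel_fin _ _ _ _ _ a01 b1 g0 h01.
exists Z => // x; rewrite /RPushBeta IZ inver (gt_eqF Z0).
have [->|x0] := eqVneq x 0; last by rewrite RPushBeta_kernel_EFin// -EFinM mulrC.
(* At 0 the factors are +oo, 1 and (1 - phi)^gamma > 0, so the product is +oo and stays so after
   division by [Z]. *)
rewrite /RPushBeta_kernel /epowR eqxx subr_lt0 a1 subr0 mul0r addr0.
rewrite /= !(ltNge _ 0) !subr_ge0 b1 g0 !andbF powR1 mule1.
by rewrite !gt0_mulye// lte_fin ?invr_gt0 ?powR_gt0// subr_gt0.
Qed.

(** Supplies the weight with which quasi-concavity and quasi-convexity are tested at a given
    intermediate point. *)
Lemma segment_barycenter (R : realFieldType) (x y z : R) :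
  x < z -> x <= y <= z ->
  exists2 l : R, 0 <= l <= 1 & l * x + (1 - l) * z = y.
Proof.
move=> xz /andP[xy yz]; have zx0 : 0 < z - x by rewrite subr_gt0.
exists ((z - y) / (z - x)); last by field; rewrite gt_eqF.
by rewrite divr_ge0 ?ler_pdivrMr//; lra.
Qed.

Theorem mainTheorem10 (R : realType) (alpha beta phi : R)
    (hbeta : 1 < beta) (halpha : 0 < alpha < 1) (hphi : 0 < phi < 1) :
  exists gamma_star : R, 0 <= gamma_star /\
    forall gamma : R, gamma_star < gamma ->
      ~ quasi_concave `[0, 1] (RPushBeta alpha beta gamma phi) /\
      ~ quasi_convex `[0, 1] (RPushBeta alpha beta gamma phi) /\
      slope_neg_pos_neg
        (fun x : R => fine (RPushBeta alpha beta gamma phi x)).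
Proof.
move: (halpha) (hphi) => /andP[a0 a1] /andP[h0 h1].
exists (1 + 2 * (beta - alpha) / phi).
have gs0 : 0 <= 1 + 2 * (beta - alpha) / phi.
  by rewrite addr_ge0// divr_ge0 ?mulr_ge0 ?(ltW h0)//; lra.
split=> // gamma hg; have g0 : 0 <= gamma by exact: le_trans (ltW hg).
have hphi' : 0 <= phi < 1 by rewrite ltW.
set K := RPushBeta_kernelR R alpha beta gamma phi.
have [Z Z0 dE] := RPushBetaE _ _ _ _ _ halpha (ltW hbeta) g0 hphi'.
have [A [a [b [A0 ap ab b1 qE]]]] :=
  slope_quadratic_factor _ _ _ _ _ halpha hbeta hphi hg.
(* At 0 this equates two junk values: [fine +oo] and [0 `^ (alpha - 1)]. *)
have fE : (fun x : R => fine (RPushBeta alpha beta gamma phi x))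
    = (fun x => Z^-1 * K x).
  apply/funext => x; rewrite dE; case: eqP => //= ->.
  by rewrite /K /RPushBeta_kernelR powR0 ?mul0r ?mulr0// lt_eqF// subr_lt0.
(* The positive cofactor of the quadratic in the derivative of the density. *)
pose D x := Z^-1 * K x / (x * (1 - x) * (1 - phi + x * phi)).
have D0 (x : R) : 0 < x < 1 -> 0 < D x.
  move=> /andP[x0 x1]; have u0 : 0 < 1 - phi + x * phi by nra.
  by rewrite /D /K /RPushBeta_kernelR !(mulr_gt0, invr_gt0, powR_gt0)// subr_gt0.
have dK (x : R) : 0 < x < 1 ->
    is_derive x 1 (fun t => Z^-1 * K t) (D x * (A * (x - a) * (b - x))).
  move=> x01; have dKx := is_derive_RPushBeta_kernelR _ alpha beta gamma phi _ hphi' x01.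
  have := is_deriveZ Z^-1 dKx.
  by rewrite /GRing.scale/= qE /D !mulrA.
have dK1 (x : R) : 0 < x < 1 ->
    derive1 (fun t => Z^-1 * K t) x = D x * (A * (x - a) * (b - x)).
  by move=> /dK[_]; rewrite derive1E.
have Kab : Z^-1 * K a < Z^-1 * K b.
  apply: (@gtr0_derive1_lt_cc _ (fun t => Z^-1 * K t) a b) => //.
  - move=> x; rewrite in_itv/= => /andP[ax xb].
    have x01 : 0 < x < 1 by lra.
    by have [] := dK _ x01.
  - move=> x; rewrite in_itv/= => /andP[ax xb].
    have x01 : 0 < x < 1 by lra.
    by rewrite dK1// pmulr_rgt0 ?D0// !mulr_gt0 ?subr_gt0.
  - apply: derivable_within_continuous => x; rewrite in_itv/= => /andP[ax xb].
    have x01 : 0 < x < 1 by lra.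
    by have [] := dK _ x01.
  - by rewrite in_itv/= lexx ltW.
  - by rewrite in_itv/= lexx ltW.
have ba : 0 < b by exact: lt_trans ab.
have I01 (x : R) : 0 <= x <= 1 -> `[0%R, 1%R]%classic x by rewrite /= in_itv.
have I0 := I01 0 ltac:(lra); have Ia := I01 a ltac:(lra).
have Ib := I01 b ltac:(lra); have I1 := I01 1 ltac:(lra).
split; last split.
(* The minimum of +oo and the density at b is the latter, so quasi-concavity would contradict
   [Kab]. *)
- move=> qc; have [||l l01 lE] := segment_barycenter _ 0 a b; [by []|lra|].
  have := qc 0 b l I0 Ib l01.
  by rewrite lE !dE eqxx !gt_eqF// minye lee_fin -/K leNgt Kab.
- move=> qc; have [||l l01 lE] := segment_barycenter _ a b 1; [lra|lra|].
  have := qc a 1 l Ia I1 l01; rewrite lE !dE oner_eq0 !gt_eqF// -/K.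
  have -> : K 1 = 0.
    by rewrite /K /RPushBeta_kernelR subrr powR0 ?mulr0 ?mul0r// gt_eqF// subr_gt0.
  (* The density is 0 at 1 and nonnegative at a, so the maximum is its value at a, again
     contradicting [Kab]. *)
  rewrite mulr0 max_l ?lee_fin; first by rewrite leNgt Kab.
  by rewrite mulr_ge0 ?RPushBeta_kernelR_ge0// invr_ge0 ltW.
- rewrite fE; split; first by move=> x /dK[].
  exists a, b; split=> //; split=> //; split=> //; split; last split.
  + move=> x /andP[x0 xa]; have x01 : 0 < x < 1 by lra.
    rewrite dK1// pmulr_rlt0 ?D0// nmulr_rlt0 ?pmulr_rlt0 ?subr_lt0 ?subr_gt0//.
    exact: lt_trans ab.
  + move=> x /andP[x0 xa]; have x01 : 0 < x < 1 by lra.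
    by rewrite dK1// pmulr_rgt0 ?D0// !mulr_gt0 ?subr_gt0.
  + move=> x /andP[x0 xa]; have x01 : 0 < x < 1 by lra.
    rewrite dK1// pmulr_rlt0 ?D0// pmulr_rlt0 ?subr_lt0// mulr_gt0 ?subr_gt0//.
    exact: lt_trans x0.
Qed.
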